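(* Let $p$ be a prime number and let $S$ be an association scheme on $X$ such that $\mathbf{O}^{\theta}(S)\simeq C_p\times C_p$ and $\{n_s \mid s\in S\setminus \mathbf{O}^{\theta}(S)\}=\{p\}$. Then $\delta(S)\ge 3$, where $\delta(S)=n_S/n_{\mathbf{O}^{\theta}(S)}$.
   Context: An association scheme on a non-empty set $X$ is a partition $S$ of $X\times X$ such that (1) $1_X=\{(x,x)\mid x\in X\}\in S$; (2) for each $s\in S$, $s^*=\{(x,y)\mid (y,x)\in s\}\in S$; (3) for all $s,t,u\in S$, the number $c_{st}^u=|xs\cap yt^*|$ is the same for all $(x,y)\in u$, where $xs=\{y\in X\mid (x,y)\in s\}$. The valency of $s$ is the positive integer $n_s=c_{ss^*}^{1_X}$; for $U\subseteq S$ put $n_U=\sum_{u\in U}n_u$; $n_S$ is the (finite) order of $S$. For nonempty $P,Q\subseteq S$, the complex product $PQ$ is the set of $s\in S$ with $c_{pq}^s\ne 0$ for some $p\in P$, $q\in Q$ (singletons $\{s\}$ are written $s$). A subset $T\subseteq S$ is closed if $\bigcup_{t\in T}t$ is an equivalence relation on $X$; it is strongly normal if moreover $s^*Ts\subseteq T$ for every $s\in S$. The thin residue $\mathbf{O}^{\theta}(S)$ is the intersection of all strongly normal closed subsets of $S$. A closed subset $T$ is thin if all its elements have valency $1$; then it is a group under the relational product. The condition $\mathbf{O}^{\theta}(S)\simeq C_p\times C_p$ means that $\mathbf{O}^{\theta}(S)$ is thin and, as a group, isomorphic to $C_p\times C_p$. *)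

(* Defs.v *)
From mathcomp Require Import all_boot all_order all_algebra all_fingroup.

Set Implicit Arguments.
Unset Strict Implicit.
Unset Printing Implicit Defensive.

Import GRing.Theory Num.Theory.

Section Relations.
Variable X : finType.
Implicit Types (r s t u : {set X * X}).

Definition diag : {set X * X} := [set z | z.1 == z.2].

Definition conv s : {set X * X} := [set z | (z.2, z.1) \in s].

(* The set xs. *)
Definition nbhd (x : X) s : {set X} := [set y | (x, y) \in s].

Definition relprod s t : {set X * X} :=
  [set z | [exists y, ((z.1, y) \in s) && ((y, z.2) \in t)]].

Definition equivb r : bool :=
  [&& [forall x, (x, x) \in r],
      [forall x, forall y, ((x, y) \in r) ==> ((y, x) \in r)] &
      [forall x, forall y, forall z,
         ((x, y) \in r) && ((y, z) \in r) ==> ((x, z) \in r)]].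

End Relations.

Section Schemes.
Variable X : finType.
Implicit Types (s t u : {set X * X}) (S T U P Q : {set {set X * X}}).

Definition num_between s t (z : X * X) : nat :=
  #|nbhd z.1 s :&: nbhd z.2 (conv t)|.

Definition association_scheme S : Prop :=
  [/\ partition S [set: X * X],
      diag X \in S,
      forall s, s \in S -> conv s \in S
    & forall s t u, s \in S -> t \in S -> u \in S ->
        forall z z', z \in u -> z' \in u ->
          num_between s t z = num_between s t z'].

(* c_{st}^u, read off at an arbitrary pair of u; in an association scheme the
   choice of the pair is irrelevant, and u is non-empty. *)
Definition structure_const s t u : nat :=
  if [pick z in u] is Some z then num_between s t z else 0%N.

Definition valency s : nat := structure_const s (conv s) (diag X).

Definition total_valency U : nat := (\sum_(u in U) valency u)%N.

Definition complex_prod S P Q : {set {set X * X}} :=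
  [set s in S | [exists p in P, exists q in Q, structure_const p q s != 0%N]].

Definition closed_subset S T : bool := (T \subset S) && equivb (cover T).

Definition strongly_normal S T : bool :=
  closed_subset S T &&
  [forall s in S,
     complex_prod S (complex_prod S [set conv s] T) [set s] \subset T].

Definition thin_residue S : {set {set X * X}} :=
  \bigcap_(T in [set T | strongly_normal S T]) T.

Definition thin S T : Prop :=
  closed_subset S T /\ forall t, t \in T -> valency t = 1%N.

(* T is thin and, as a group under the relational product, isomorphic to gT. *)
Definition thin_isog S T (gT : finGroupType) : Prop :=
  thin S T /\
  exists f : {set X * X} -> gT,
    [/\ {in T &, injective f},
        f @: T = [set: gT]
      & {in T &, {morph f : s t / relprod s t >-> (s * t)%g}}].

Definition delta S : rat :=
  ((total_valency S)%:R / (total_valency (thin_residue S))%:R)%R.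

End Schemes.

(* 'Z_p is the cyclic group of order p only when 1 < p. *)
Definition CpxCp (p : nat) : finGroupType := ('Z_p * 'Z_p)%type.

(* Main.v *)
(* Let T be the thin residue, whose classes on X all have size p^2. If
   delta(S) < 3, then T has at most two classes. For s outside T, the product
   s s^* is the stabiliser of s under left multiplication by T. Since T is
   transitive on S \ T and abelian, this stabiliser K does not depend on s, so
   that s^* K s = s^* s = K and K is strongly normal. Hence T is contained in K,
   and s joins a point to a whole class of T, which contradicts p < p^2. *)
Require Import Defs.
From mathcomp Require Import all_boot all_order all_algebra all_fingroup.

Set Implicit Arguments.
Unset Strict Implicit.
Unset Printing Implicit Defensive.

Import GRing.Theory Num.Theory.

(** * Paths, neighbourhoods and valencies in an association scheme *)

Section SchemeTheory.
Variables (X : finType) (S : {set {set X * X}}).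
Hypothesis S_scheme : association_scheme S.
Implicit Types (s t u v w : {set X * X}) (P Q T U : {set {set X * X}}).
Implicit Types x y z a b : X.

Lemma mem_conv s x y : ((x, y) \in conv s) = ((y, x) \in s).
Proof. by rewrite inE. Qed.

Lemma scheme_conv s : s \in S -> conv s \in S.
Proof. by case: S_scheme => _ _ H _; exact: H. Qed.

Lemma scheme_rel x y : exists2 u, u \in S & (x, y) \in u.
Proof.
have [partS _ _ _] := S_scheme; have cS := cover_partition partS.
have: (x, y) \in cover S by rewrite cS inE.
by case/bigcupP=> u uS xyu; exists u.
Qed.

Lemma scheme_eq s t x y :
  s \in S -> t \in S -> (x, y) \in s -> (x, y) \in t -> s = t.
Proof.
case: S_scheme => /and3P[_ tS _] _ _ _ sS tS' xys xyt.
by rewrite -(def_pblock tS sS xys) (def_pblock tS tS' xyt).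
Qed.

(** The count [num_between s t] is constant on [u]; being positive at one pair, it is positive at
    every pair. Most later uses of regularity have this form. *)
Lemma scheme_triangle s t u x y z x' y' :
    s \in S -> t \in S -> u \in S -> (x, z) \in s -> (z, y) \in t ->
    (x, y) \in u -> (x', y') \in u ->
  exists2 z', (x', z') \in s & (z', y') \in t.
Proof.
case: S_scheme => _ _ _ reg sS tS uS xzs zyt xyu xyu'.
have: 0 < num_between s t (x, y).
  by apply/card_gt0P; exists z; rewrite !inE /= xzs.
rewrite (reg _ _ _ sS tS uS _ _ xyu xyu') => /card_gt0P[z'].
by rewrite !inE => /andP[xz zy]; exists z'.
Qed.

Lemma valency_nbhd s x : s \in S -> valency s = #|nbhd x s|.
Proof.
case: S_scheme => _ dS _ reg sS; rewrite /valency /structure_const.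
case: pickP => [w wd | /(_ (x, x))]; last by rewrite inE eqxx.
have xd : (x, x) \in diag X by rewrite inE eqxx.
rewrite (reg _ _ _ sS (scheme_conv sS) dS _ _ wd xd).
by congr #|pred_of_set _|; apply/setP=> y; rewrite !inE andbb.
Qed.

Lemma scheme_nonempty s : s \in S -> exists e : X * X, e \in s.
Proof.
case: S_scheme => /and3P[_ _ S0] _ _ _ sS.
by apply/set0Pn; apply: contraNneq S0 => <-.
Qed.

Lemma nbhd_inhabited s x : s \in S -> exists y, (x, y) \in s.
Proof.
move=> sS; have [[a b] ab] := scheme_nonempty sS.
case: S_scheme => _ dS _ _.
have ba : (b, a) \in conv s by rewrite mem_conv.
have aa : (a, a) \in diag X by rewrite inE.
have xx : (x, x) \in diag X by rewrite inE.
have [y xy _] := scheme_triangle sS (scheme_conv sS) dS ab ba aa xx.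
by exists y.
Qed.

(** Double counting of the pairs [(u, y)] with [u] in [U] and [y] in [nbhd x u]: each [y] occurs
    once since the elements of [S] are disjoint. For closed [U] this makes n_U the size of every
    class of [U] on X. *)
Lemma total_valency_nbhd U x :
  U \subset S -> total_valency U = #|nbhd x (cover U)|.
Proof.
move=> /subsetP US.
have -> : nbhd x (cover U) = \bigcup_(u in U) nbhd x u.
  apply/setP=> y; rewrite inE; apply/bigcupP/bigcupP=> -[u uU h];
  by exists u => //; move: h; rewrite inE.
rewrite /total_valency; under eq_bigr => u uU do rewrite (valency_nbhd x (US u uU)).
rewrite (eq_bigr (fun u => \sum_(y | y \in nbhd x u) 1)); last first.
  by move=> u _; rewrite sum1_card.
rewrite (exchange_big_dep (mem (\bigcup_(u in U) nbhd x u))) /=; last first.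
  by move=> u y uU yu; apply/bigcupP; exists u.
rewrite -[RHS]sum1_card; apply: eq_bigr => y /bigcupP[u uU yu].
rewrite (bigD1 u) ?uU //= big1 ?addn0 // => w /andP[/andP[wU yw] /eqP[]].
by move: yu yw; rewrite !inE => yu yw; apply: (scheme_eq _ _ yw yu); apply: US.
Qed.

Lemma complex_prodP P Q w x y :
    P \subset S -> Q \subset S -> w \in complex_prod S P Q -> (x, y) \in w ->
  exists z, exists2 s, s \in P & exists2 t, t \in Q & (x, z) \in s /\ (z, y) \in t.
Proof.
move=> /subsetP PS /subsetP QS; rewrite inE => /andP[wS].
case/exists_inP=> s sP /exists_inP[t tQ]; rewrite /structure_const.
case: pickP => [[a b] abw|//]; rewrite -lt0n => /card_gt0P[z].
rewrite !inE => /andP[az zb] xyw.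
have [z' xz zy] := scheme_triangle (PS s sP) (QS t tQ) wS az zb abw xyw.
by exists z'; exists s => //; exists t.
Qed.


(** * Thin closed subsets acting by translation *)

Section ThinClosedSubset.
Variable T : {set {set X * X}}.
Hypothesis T_thin : thin S T.

Lemma thin_subset : T \subset S.
Proof. by case: T_thin => /andP[]. Qed.

Lemma thin_in t : t \in T -> t \in S.
Proof. exact: subsetP thin_subset t. Qed.

Lemma thin_sym x y : (x, y) \in cover T -> (y, x) \in cover T.
Proof.
case: T_thin => /andP[_ /and3P[_ /forallP symT _]] _.
by have /forallP/(_ y)/implyP := symT x.
Qed.

Lemma thin_trans y x z :
  (x, y) \in cover T -> (y, z) \in cover T -> (x, z) \in cover T.
Proof.
case: T_thin => /andP[_ /and3P[_ _ /forallP trT]] _ xy yz.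
by have /forallP/(_ y)/forallP/(_ z)/implyP := trT x; apply; apply/andP.
Qed.

Lemma cover_mem t x y : t \in S -> (x, y) \in t -> ((x, y) \in cover T) = (t \in T).
Proof.
move=> tS xyt; apply/bigcupP/idP => [[u uT xyu]|tT]; last by exists t.
by rewrite (scheme_eq tS (thin_in uT) xyt xyu).
Qed.

Lemma conv_mem t : t \in S -> (conv t \in T) = (t \in T).
Proof.
move=> tS; have [[x y] xy] := scheme_nonempty tS.
have yx : (y, x) \in conv t by rewrite mem_conv.
rewrite -(cover_mem tS xy) -(cover_mem (scheme_conv tS) yx).
by apply/idP/idP; apply: thin_sym.
Qed.

Lemma thin_functional t x y z : t \in T -> (x, y) \in t -> (x, z) \in t -> y = z.
Proof.
move=> tT xy xz; have /eqP := valency_nbhd x (thin_in tT).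
case: T_thin => _ -> //; rewrite eq_sym => /cards1P[w nw].
have /set1P -> : y \in [set w] by rewrite -nw inE.
by have /set1P -> : z \in [set w] by rewrite -nw inE.
Qed.

(** Regularity yields some [t]-successor of [z] that is [u]-related to [y'], and thinness forces it
    to be [z']. Hence translating the left end by [t] carries all of [s] into the single relation
    [u]. *)
Lemma thin_transport t s u x x' y z z' y' :
    t \in T -> s \in S -> u \in S ->
    (x, x') \in t -> (x, y) \in s -> (x', y) \in u ->
    (z, z') \in t -> (z, y') \in s ->
  (z', y') \in u.
Proof.
move=> tT sS uS xx' xys xyu zz' zw.
have [z'' zz'' z''y'] := scheme_triangle (thin_in tT) uS sS xx' xyu xys zw.
by rewrite (thin_functional tT zz' zz'').
Qed.

(** The product is the one relation [w] met by a single path: translation by [conv u] gives one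
    inclusion, regularity the other. *)
Lemma relprod_thin u v : u \in T -> v \in T -> relprod u v \in T.
Proof.
move=> uT vT; have [uS vS] := (thin_in uT, thin_in vT).
have [[x y] xy] := scheme_nonempty uS.
have [z yz] := nbhd_inhabited y vS.
have [w wS xz] := scheme_rel x z.
have wT : w \in T.
  rewrite -(cover_mem wS xz).
  by apply: (@thin_trans y); [rewrite (cover_mem uS xy)|rewrite (cover_mem vS yz)].
suff -> : relprod u v = w by [].
apply/setP=> -[x' z']; rewrite inE /=; apply/exists_inP/idP => [[y' xy' yz']|xz'].
  by apply: (@thin_transport (conv u) v w y x z y'); rewrite ?conv_mem ?mem_conv.
have [y'] := scheme_triangle uS vS wS xy yz xz xz'.
by exists y'.
Qed.

Lemma total_valency_thin : total_valency T = #|T|.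
Proof.
by rewrite -sum1_card; apply: eq_bigr => t tT; case: T_thin => _ ->.
Qed.

(** * Stabilisers for a commutative T with at most two classes *)

Hypothesis T_comm : {in T &, commutative (@relprod X)}.

(** Completes a parallelogram: a path along [u] then [v] can be replaced by one along [v] then [u],
    whose midpoint is determined by thinness. *)
Lemma thin_commute u v x y y' z :
    u \in T -> v \in T -> (x, y) \in u -> (y, z) \in v -> (x, y') \in v ->
  (y', z) \in u.
Proof.
move=> uT vT xy yz xy'.
have : (x, z) \in relprod v u.
  by rewrite T_comm // inE; apply/exists_inP; exists y.
rewrite inE => /exists_inP[y'' xy'' y''z].
by rewrite (thin_functional vT xy' xy'').
Qed.

Hypothesis two_classes : forall x y z,
  (x, y) \notin cover T -> (z, y) \notin cover T -> (x, z) \in cover T.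

Lemma mem_relprod_conv s x z :
  reflect (exists2 y, (x, y) \in s & (z, y) \in s) ((x, z) \in relprod s (conv s)).
Proof.
rewrite inE; apply: (iffP exists_inP) => -[y xy zy]; exists y => //.
  by rewrite mem_conv in zy.
by rewrite mem_conv.
Qed.

(* Both [s] and [u] meet the two classes of [T], so that [u] is contained in
   [v s] for some [v] in [T]; as [T] is commutative, the left stabilisers of
   [s] and [u] in [T] agree. *)
Lemma relprod_conv_stab s u x x' y :
    s \in S :\: T -> u \in S :\: T -> (x, x') \in relprod s (conv s) ->
  (x, y) \in u -> (x', y) \in u.
Proof.
case/setDP=> sS sT /setDP[uS uT] /mem_relprod_conv[a xa x'a] xy.
have /bigcupP[t tT xx'] : (x, x') \in cover T.
  by apply: (@two_classes x a x'); rewrite (cover_mem sS).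
have [z] := nbhd_inhabited y (scheme_conv sS); rewrite mem_conv => zy.
have /bigcupP[v vT xz] : (x, z) \in cover T.
  by apply: (@two_classes x y z); [rewrite (cover_mem uS)|rewrite (cover_mem sS)].
have [z' zz'] := nbhd_inhabited z (thin_in tT).
have z'y : (z', y) \in s.
  exact: (thin_transport tT sS sS xx' xa x'a zz' zy).
have x'z' : (x', z') \in v by apply: (thin_commute vT tT xz zz' xx').
apply: (@thin_transport (conv v) s u z x y z'); rewrite ?conv_mem ?mem_conv //.
exact: thin_in.
Qed.

(** This is the complex product of [s] and [conv s], expressed by inclusion of relations. For [s]
    outside [T] it consists of the [t] in [T] whose left translation preserves [s]. *)
Definition stabiliser s := [set t in S | t \subset relprod s (conv s)].

(** By regularity, an element of [S] that meets [relprod s (conv s)] lies inside it. *)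
Lemma cover_stabiliser s : s \in S -> cover (stabiliser s) = relprod s (conv s).
Proof.
move=> sS; apply/setP=> -[x z]; apply/bigcupP/idP => [[t]|xz].
  by rewrite inE => /andP[_ /subsetP sub] /sub.
have [t tS xzt] := scheme_rel x z; exists t => //; rewrite inE tS.
case/mem_relprod_conv: xz => y xy zy; apply/subsetP=> -[x' z'] xz'.
have yz : (y, z) \in conv s by rewrite mem_conv.
have [y' xy'] := scheme_triangle sS (scheme_conv sS) tS xy yz xzt xz'.
by rewrite mem_conv => zy'; apply/mem_relprod_conv; exists y'.
Qed.

Lemma stabiliser_strongly_normal s :
  s \in S :\: T -> strongly_normal S (stabiliser s).
Proof.
move=> sST; have sS : s \in S by case/setDP: sST.
have KS : stabiliser s \subset S by apply/subsetP=> t; rewrite inE => /andP[].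
have Rsym x y : (x, y) \in relprod s (conv s) -> (y, x) \in relprod s (conv s).
  by case/mem_relprod_conv => z xz yz; apply/mem_relprod_conv; exists z.
have stab := relprod_conv_stab sST.
apply/andP; split.
  rewrite /closed_subset KS /= cover_stabiliser //; apply/and3P; split.
  - apply/forallP=> x; have [y xy] := nbhd_inhabited x sS.
    by apply/mem_relprod_conv; exists y.
  - by apply/forallP=> x; apply/forallP=> y; apply/implyP=> /Rsym.
  apply/forallP=> x; apply/forallP=> y; apply/forallP=> z; apply/implyP.
  case/andP=> xy /mem_relprod_conv[a ya za].
  by apply/mem_relprod_conv; exists a => //; apply: stab sST (Rsym _ _ xy) ya.
apply/forall_inP=> u uS; apply/subsetP=> w wP.
have wS : w \in S by move: wP; rewrite inE => /andP[].
have uS' : [set u] \subset S by rewrite sub1set.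
have cuS : [set conv u] \subset S by rewrite sub1set scheme_conv.
rewrite inE wS; apply/subsetP=> -[a b] ab.
have PS : complex_prod S [set conv u] (stabiliser s) \subset S.
  by apply/subsetP=> q; rewrite inE => /andP[].
have [x' [q qP [_ /set1P-> [aq x'b]]]] := complex_prodP PS uS' wP ab.
have [x [_ /set1P-> [t tK [+ xx']]]] := complex_prodP cuS KS qP aq.
rewrite mem_conv => xa.
have tR : t \subset relprod s (conv s) by move: tK; rewrite inE => /andP[].
have xRx' := subsetP tR _ xx'.
(* The path from [a] to [b] runs along [conv u], [t], [u]. If [u] is in [T], commutativity cancels
   [u] and leaves [(a, b)] in [t]. *)
have [uT|uT] := boolP (u \in T).
  have tT : t \in T.
    have tS : t \in S by apply: (subsetP KS).
    rewrite -(cover_mem tS xx'); case/mem_relprod_conv: xRx' => y xy x'y.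
    case/setDP: sST => _ sT.
    by apply: (@two_classes x y x'); rewrite (cover_mem sS).
  by apply: (subsetP tR); apply: (thin_commute tT uT xx' x'b xa).
have uST : u \in S :\: T by rewrite inE uT.
(* Outside [T], [t] stabilises [u] as well as [s], so [x] is [u]-related to both [a] and [b]. Thus
   [(a, b)] lies in the product of [conv u] with its converse, whose elements stabilise [s] too. *)
have xb := stab _ _ _ _ uST (Rsym _ _ xRx') x'b.
have cuST : conv u \in S :\: T by rewrite inE conv_mem // uT scheme_conv.
have [c ac] := nbhd_inhabited a sS; apply/mem_relprod_conv; exists c => //.
apply: (relprod_conv_stab cuST sST _ ac).
by apply/mem_relprod_conv; exists x; rewrite mem_conv.
Qed.

End ThinClosedSubset.

(** * Counting points over three classes *)

Lemma three_classes_card T x y z : thin S T ->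
    (x, y) \notin cover T -> (z, y) \notin cover T -> (x, z) \notin cover T ->
  3 * total_valency T <= total_valency S.
Proof.
move=> Tt xy zy xz; have TS := thin_subset Tt.
pose C a := nbhd a (cover T).
have dC a b : (a, b) \notin cover T -> [disjoint C a & C b].
  move=> ab; rewrite disjoint_subset; apply/subsetP=> c; rewrite !inE => ac.
  by apply: contra ab => bc; apply: (thin_trans Tt ac); apply: thin_sym.
have cC a : total_valency T = #|C a| by apply: total_valency_nbhd.
have dU : [disjoint C x :|: C z & C y].
  by rewrite -setI_eq0 setIUl !disjoint_setI0 ?dC ?setU0.
(* The neighbourhood of [x] in [cover S] is all of X, so it contains the disjoint classes of [x],
   [z] and [y], each of size n_T. *)
rewrite (@total_valency_nbhd S x) //.
have -> : 3 * total_valency T = #|(C x :|: C z) :|: C y|.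
  rewrite !cardsU (disjoint_setI0 dU) (disjoint_setI0 (dC _ _ xz)) !cards0.
  by rewrite -!cC !subn0 !mulSn mul0n addn0 addnA.
apply/subset_leq_card/subsetP => w _; rewrite inE.
by have [u uS xw] := scheme_rel x w; apply/bigcupP; exists u.
Qed.

Lemma thin_residue_sub T : strongly_normal S T -> thin_residue S \subset T.
Proof. by move=> nT; apply: bigcap_inf; rewrite inE. Qed.

End SchemeTheory.

(** * The group of order p^2 and the conclusion *)

Lemma CpxCp_comm p (a b : CpxCp p) : (a * b = b * a)%g.
Proof. case: a b => [a1 a2] [b1 b2]; congr (_, _); exact: Zp_mulgC. Qed.

Lemma card_CpxCp p : 1 < p -> #|[set: CpxCp p]| = p * p.
Proof. by move=> p1; rewrite cardsT card_prod card_ord Zp_cast. Qed.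

Theorem proposition3p1 (p : nat) (X : finType) (S : {set {set X * X}})
    (p_prime : prime p)
    (X_nonempty : 0 < #|X|)
    (S_scheme : association_scheme S)
    (residue_CpCp : thin_isog S (thin_residue S) (CpxCp p))
    (valencies : [seq valency s | s in S :\: thin_residue S] =i [:: p]) :
  (3%:R <= delta S)%R.
Proof.
set T := thin_residue S; have p1 := prime_gt1 p_prime.
have [Tt [f [f_inj f_onto f_mul]]] := residue_CpCp.
have cardT : #|T| = p * p.
  by rewrite -(card_in_imset f_inj) f_onto card_CpxCp.
have Tcomm : {in T &, commutative (@relprod X)}.
  (* Commutativity is pulled back along [f]; its injectivity applies because both products lie in
     [T]. *)
  move=> u v uT vT; apply: f_inj; try exact: (relprod_thin S_scheme Tt).
  by rewrite !f_mul // CpxCp_comm.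
have val_p s : s \in S :\: T -> valency s = p.
  move=> sST; apply/eqP; rewrite -mem_seq1 -valencies.
  by apply/imageP; exists s.
(* The valencies outside [T] form exactly {p}, so some [s] lies outside [T]. *)
have [s sST] : exists s, s \in S :\: T.
  have : p \in [seq valency s | s in S :\: T] by rewrite valencies mem_head.
  by case/imageP=> s sST _; exists s.
have [sS sT] : s \in S /\ s \notin T by case/setDP: sST.
have pp0 : 0 < p * p by rewrite muln_gt0 prime_gt0.
rewrite /delta -/T (total_valency_thin Tt) cardT.
rewrite ler_pdivlMr ?ltr0n // -natrM ler_nat.
rewrite -cardT -(total_valency_thin Tt) leqNgt; apply/negP=> lt3.
have two x y z :
    (x, y) \notin cover T -> (z, y) \notin cover T -> (x, z) \in cover T.
  move=> xy zy; apply: contraLR lt3 => xz.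
  by rewrite -leqNgt (three_classes_card S_scheme Tt xy zy xz).
have subK := thin_residue_sub
  (stabiliser_strongly_normal S_scheme Tt Tcomm two sST).
have [[x y] xy] := scheme_nonempty S_scheme sS.
(* The points to be collected are left ends of [s], so the valency needed is that of [conv s]. *)
have csST : conv s \in S :\: T.
  by rewrite inE (conv_mem S_scheme Tt) // sT (scheme_conv S_scheme).
(* All of [T] stabilises [s], so the whole class of [x] is [s]-related to [y]. Taking cardinalities
   gives p^2 <= p. *)
have : nbhd x (cover T) \subset nbhd y (conv s).
  apply/subsetP=> z; rewrite !inE /= => /bigcupP[t tT xz].
  have := subsetP subK _ tT; rewrite inE => /andP[_ /subsetP/(_ _ xz) xRz].
  exact: (relprod_conv_stab S_scheme Tt Tcomm two sST sST xRz xy).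
move/subset_leq_card.
rewrite -(total_valency_nbhd S_scheme x (thin_subset Tt)) (total_valency_thin Tt).
rewrite -(valency_nbhd S_scheme) ?(scheme_conv S_scheme) // val_p // cardT.
by rewrite leqNgt ltn_Pmull ?prime_gt0.
Qed.
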